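(* For indexed forests $F,G$, the coefficients $c^H_{F,G}(\mathbf t)\in\mathbb Z[\mathbf t]$ in the expansion $$\mathfrak P_F(\mathbf x;\mathbf t)\,\mathfrak P_G(\mathbf x;\mathbf t)=\sum_H c^H_{F,G}(\mathbf t)\,\mathfrak P_H(\mathbf x;\mathbf t)$$ are Graham-positive, i.e. lie in $\mathbb Z_{\ge0}[t_2-t_1,t_3-t_2,\dots]$.
   Context: $\mathbf x=(x_1,x_2,\dots)$, $\mathbf t=(t_1,t_2,\dots)$. Indexed forests: sequences $F=(T_1,T_2,\dots)$ of binary plane trees (each node a leaf or an internal node with ordered left/right children), all but finitely many one-node trees; leaves identified with $\mathbb N$ left to right; $\emptyset$ has no internal nodes. $\rho_F(v)$: leaf reached from internal node $v$ going repeatedly to left children; terminal: both children leaves; $\mathrm{Qdes}(F)=\{\rho_F(v):v\text{ terminal}\}$; $F/i$ deletes the terminal node with $\rho_F(v)=i$ (replacing it and its leaves by one leaf, relabeling). Double forest polynomials: $R_i^-f=f(x_1,\dots,x_{i-1},t_i,x_i,\dots;\mathbf t)$, $R_i^+f=f(x_1,\dots,x_i,t_i,x_{i+1},\dots;\mathbf t)$, $E_if=(R_i^+f-R_i^-f)/(x_i-t_i)$; $\mathfrak P_F$ is the unique homogeneous family ($\deg x_i=\deg t_i=1$) with $\mathfrak P_F(\mathbf t;\mathbf t)=\delta_{F,\emptyset}$ and $E_i\mathfrak P_F=\mathfrak P_{F/i}(\mathbf x;\widehat{\mathbf t}_i)$ if $i\in\mathrm{Qdes}(F)$, else $0$, $\widehat{\mathbf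 t}_i=(t_1,\dots,t_{i-1},t_{i+1},\dots)$. These form a $\mathbb Z[\mathbf t]$-basis of $\mathbb Z[\mathbf t][\mathbf x]$. *)

(* Defs.v *)
From HB Require Import structures.
From mathcomp Require Import all_boot all_algebra.
From mathcomp Require Import finmap.
From mathcomp.multinomials Require Import monalg.

Set Implicit Arguments.
Unset Strict Implicit.
Unset Printing Implicit Defensive.

Import GRing.Theory.
Local Open Scope ring_scope.

Inductive tree : Type := Leaf | Node of tree & tree.

Fixpoint tree_enc (t : tree) : GenTree.tree nat :=
  match t with
  | Leaf => GenTree.Node 0 [::]
  | Node l r => GenTree.Node 1 [:: tree_enc l; tree_enc r]
  end.

Fixpoint tree_dec (g : GenTree.tree nat) : option tree :=
  match g with
  | GenTree.Node 0 [::] => Some Leaf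
  | GenTree.Node 1 [:: gl; gr] =>
      match tree_dec gl, tree_dec gr with
      | Some l, Some r => Some (Node l r)
      | _, _ => None
      end
  | _ => None
  end.

Lemma tree_encK : pcancel tree_enc tree_dec.
Proof. by elim=> [|l IHl r IHr] //=; rewrite IHl IHr. Qed.

HB.instance Definition _ := Countable.copy tree (pcan_type tree_encK).

Definition is_leaf (t : tree) : bool := if t is Leaf then true else false.

Fixpoint nleaves (t : tree) : nat :=
  match t with Leaf => 1 | Node l r => nleaves l + nleaves r end.

(* An indexed forest (T_0, T_1, ...) is represented by the finite list of
   its trees up to the last non-trivial one; all later trees are single
   leaves.  The representation is made canonical by requiring that the
   list is empty or its last tree is not a leaf. *)
Definition normal_seq (s : seq tree) : bool :=
  if s is [::] then true else ~~ is_leaf (last Leaf s).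

Definition forest := {s : seq tree | normal_seq s}.
HB.instance Definition _ := [Countable of forest by <:].

Definition forest_empty : forest := exist _ [::] isT.

Fixpoint strip (s : seq tree) : seq tree :=
  match s with
  | [::] => [::]
  | t :: s' => let s'' := strip s' in
               if (s'' == [::]) && is_leaf t then [::] else t :: s''
  end.

Lemma strip_normal s : normal_seq (strip s).
Proof.
elim: s => [|t s IH] //=.
case E: (strip s) IH => [|u s'] /= IH.
  by case: t.
by [].
Qed.

Definition mk_forest (s : seq tree) : forest := exist _ (strip s) (strip_normal s).

(* Leaves are numbered 0,1,2,... from left to right (0-based; the paper
   uses 1,2,3,...).  [off] is the label of the leftmost leaf of [t].
   rho(v) of an internal node v is the label of the leftmost leaf of the
   subtree at v; a node is terminal iff it is [Node Leaf Leaf]. *)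
Fixpoint tree_qdes (off : nat) (t : tree) : seq nat :=
  match t with
  | Leaf => [::]
  | Node Leaf Leaf => [:: off]
  | Node l r => tree_qdes off l ++ tree_qdes (off + nleaves l) r
  end.

Fixpoint tree_contract (i off : nat) (t : tree) : tree :=
  match t with
  | Leaf => Leaf
  | Node Leaf Leaf => if off == i then Leaf else t
  | Node l r => Node (tree_contract i off l)
                     (tree_contract i (off + nleaves l) r)
  end.

Fixpoint seq_qdes (off : nat) (s : seq tree) : seq nat :=
  match s with
  | [::] => [::]
  | t :: s' => tree_qdes off t ++ seq_qdes (off + nleaves t) s'
  end.

Fixpoint seq_contract (i off : nat) (s : seq tree) : seq tree :=
  match s with
  | [::] => [::]
  | t :: s' => tree_contract i off t :: seq_contract i (off + nleaves t) s'
  end.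

Definition Qdes (F : forest) : seq nat := seq_qdes 0 (val F).

(* F / i (meaningful when i \in Qdes F) *)
Definition fcontract (F : forest) (i : nat) : forest :=
  mk_forest (seq_contract i 0 (val F)).

(* Variable (false, i) is x_(i+1), variable (true, i) is t_(i+1).      *)

Definition var := (bool * nat)%type.
Definition xtpoly := {malg int[{cmonom var}]}.

Definition X (i : nat) : xtpoly := << ucm ((false, i) : var) >>.
Definition T (i : nat) : xtpoly := << ucm ((true, i) : var) >>.

Definition msubst (s : var -> xtpoly) (p : xtpoly) : xtpoly :=
  mmap (fun c : int => c%:MP : xtpoly)
       (fun m : {cmonom var} => \prod_(v <- finsupp m) s v ^+ (m v)) p.

Definition Rminus (i : nat) (p : xtpoly) : xtpoly :=
  msubst (fun v => if v.1 then T v.2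
                   else if (v.2 < i)%N then X v.2
                   else if v.2 == i then T i else X v.2.-1) p.

Definition Rplus (i : nat) (p : xtpoly) : xtpoly :=
  msubst (fun v => if v.1 then T v.2
                   else if (v.2 <= i)%N then X v.2
                   else if v.2 == i.+1 then T i else X v.2.-1) p.

Definition that (i : nat) (p : xtpoly) : xtpoly :=
  msubst (fun v => if v.1 then (if (v.2 < i)%N then T v.2 else T v.2.+1)
                   else X v.2) p.

Definition xtot (p : xtpoly) : xtpoly :=
  msubst (fun v => T v.2) p.

Definition homogeneous (p : xtpoly) : Prop :=
  exists d : nat, forall m : {cmonom var}, m \in msupp p -> mdeg m = d.

Definition in_Zt (p : xtpoly) : Prop :=
  forall m : {cmonom var}, m \in msupp p -> forall j : nat, m ((false, j) : var) = 0%N.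

(* The characterization of the double forest polynomials.  The divided
   difference E_i f = (R_i^+ f - R_i^- f)/(x_i - t_i) is written out as
   the (unique, Z[x;t] being a domain) identity
   (x_i - t_i) * E_i f = R_i^+ f - R_i^- f. *)
Definition double_forest_family (P : forest -> xtpoly) : Prop :=
  [/\ forall F, homogeneous (P F),
      forall F, xtot (P F) = (F == forest_empty)%:R &
      forall F (i : nat),
        Rplus i (P F) - Rminus i (P F) =
        if i \in Qdes F then (X i - T i) * that i (P (fcontract F i)) else 0].

Inductive graham_pos : xtpoly -> Prop :=
  | gp_nat (n : nat) : graham_pos n%:R
  | gp_gen (i : nat) : graham_pos (T i.+1 - T i)
  | gp_add p q : graham_pos p -> graham_pos q -> graham_pos (p + q)
  | gp_mul p q : graham_pos p -> graham_pos q -> graham_pos (p * q).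

Definition expansion (P : forest -> xtpoly) (f : xtpoly)
    (S : seq forest) (c : forest -> xtpoly) : Prop :=
  [/\ uniq S, forall H, H \notin S -> c H = 0,
      forall H, in_Zt (c H) &
      f = \sum_(H <- S) c H * P H].

(* Main.v *)
Require Import Defs.
From HB Require Import structures.
From mathcomp Require Import all_boot all_algebra.
From mathcomp Require Import finmap.
From mathcomp.multinomials Require Import monalg.
From mathcomp Require Import ring zify.

(** The coefficient c^H is ev_t E_{i1} ... E_{ik} (P_F P_G), where i1, ..., ik
    successively contract H to the empty forest.  The Leibniz rule
    E_i(fg) = E_i f R_i^+ g + R_i^- f E_i g turns it into a sum of products
    ev_t W(P_F) ev_t W'(P_G), where W and W' are words in the operators
    E, R^-, R^+, so it suffices that each ev_t W(P_F) is Graham-positive.  If W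
    contains only E's, the value is 0 or 1.  Otherwise the last R^-, R^+ of W is
    moved to the final evaluation by commutation relations such as
      E_i R_i^+ = R_i^+ E_i + R_i^- E_{i+1} + (t_{i+1} - t_i) E_i E_i,
    whose coefficients are Graham-positive, and is removed there by
      ev_t R_j^- = ev_t  and  ev_t R_j^+ = ev_t + (t_{j+1} - t_j) ev_t E_j. *)

Set Implicit Arguments.
Unset Strict Implicit.
Unset Printing Implicit Defensive.

Import GRing.Theory.

(** * Grafting and contraction of forests *)

Fixpoint tree_size (u : tree) : nat :=
  if u is Node l r then (tree_size l + tree_size r).+1 else 0.

(** Grafting inverts contraction: by [graftK] and [fcontractK], [graft] at [i] is a bijection from
    all forests onto those with [i] in [Qdes]. *)
Fixpoint tree_graft (k : nat) (u : tree) : tree :=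
  match u with
  | Leaf => Node Leaf Leaf
  | Node l r => if k < nleaves l then Node (tree_graft k l) r
                else Node l (tree_graft (k - nleaves l) r)
  end.

(** Past the end of the list every tree is a leaf, so [k] trivial trees are restored before the new
    node. *)
Fixpoint seq_graft (k : nat) (s : seq tree) : seq tree :=
  match s with
  | [::] => ncons k Leaf [:: Node Leaf Leaf]
  | u :: s' => if k < nleaves u then tree_graft k u :: s'
               else u :: seq_graft (k - nleaves u) s'
  end.

Definition graft (F : forest) (k : nat) : forest := mk_forest (seq_graft k (val F)).

Definition forest_size (F : forest) : nat := sumn (map tree_size (val F)).

Lemma tree_qdesE off l r : tree_qdes off (Node l r) =
  if is_leaf l && is_leaf r then [:: off]
  else tree_qdes off l ++ tree_qdes (off + nleaves l) r.
Proof. by case: l r => [|ll lr] [|rl rr]. Qed.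

Lemma tree_contractE i off l r : tree_contract i off (Node l r) =
  if is_leaf l && is_leaf r then (if off == i then Leaf else Node l r)
  else Node (tree_contract i off l) (tree_contract i (off + nleaves l) r).
Proof. by case: l r => [|ll lr] [|rl rr]. Qed.

Lemma is_leafP u : reflect (u = Leaf) (is_leaf u).
Proof. by case: u => [|l r]; constructor. Qed.

Lemma tree_qdes_bound off u q : q \in tree_qdes off u ->
  off <= q /\ q.+1 < off + nleaves u.
Proof.
elim: u off => // l IHl r IHr off; rewrite tree_qdesE /=.
case: ifP => [/andP[/is_leafP -> /is_leafP ->]|_].
  by rewrite inE => /eqP ->; rewrite /=; lia.
by rewrite mem_cat => /orP[/IHl|/IHr]; lia.
Qed.

Lemma tree_contract_notin i off u :
  i \notin tree_qdes off u -> tree_contract i off u = u.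
Proof.
elim: u off => // l IHl r IHr off; rewrite tree_qdesE tree_contractE.
case: ifP => _; first by rewrite inE eq_sym => /negbTE ->.
by rewrite mem_cat negb_or => /andP[/IHl -> /IHr ->].
Qed.

Lemma nleaves_contract i off u : i \in tree_qdes off u ->
  (nleaves (tree_contract i off u)).+1 = nleaves u.
Proof.
elim: u off => // l IHl r IHr off; rewrite tree_qdesE tree_contractE /=.
case: ifP => [/andP[/is_leafP -> /is_leafP ->]|_].
  by rewrite inE eq_sym => ->.
rewrite mem_cat /=.
have [il _|il /= ir] := boolP (i \in tree_qdes off l); last first.
  by rewrite (tree_contract_notin il) -(IHr _ ir) addnS.
have ir : i \notin tree_qdes (off + nleaves l) r.
  by apply/negP => /tree_qdes_bound; have := tree_qdes_bound il; lia.
by rewrite (tree_contract_notin ir) -(IHl _ il) addSn.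
Qed.

Lemma nleaves_graft k u : nleaves (tree_graft k u) = (nleaves u).+1.
Proof.
by elim: u k => //= l IHl r IHr k; case: ifP => _ /=; rewrite ?IHl ?IHr ?addnS.
Qed.

Lemma tree_graft_nleaf k u : is_leaf (tree_graft k u) = false.
Proof. by case: u => //= l r; case: ifP. Qed.

Lemma tree_size_graft k u : tree_size (tree_graft k u) = (tree_size u).+1.
Proof.
by elim: u k => //= l IHl r IHr k; case: ifP => _ /=; rewrite ?IHl ?IHr ?addnS.
Qed.

Lemma mem_qdes_graft k off u : k < nleaves u ->
  off + k \in tree_qdes off (tree_graft k u).
Proof.
elim: u k off => [|l IHl r IHr] k off /=; first by case: k => // _; rewrite addn0 inE.
move=> kb; case: ltnP => kl; rewrite tree_qdesE tree_graft_nleaf ?andbF /= mem_cat.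
  by rewrite IHl.
have -> : off + k = off + nleaves l + (k - nleaves l) by lia.
by rewrite IHr ?orbT //; lia.
Qed.

Lemma tree_graftK k off u : k < nleaves u ->
  tree_contract (off + k) off (tree_graft k u) = u.
Proof.
elim: u k off => [|l IHl r IHr] k off /=.
  by case: k => // _; rewrite addn0 eqxx.
move=> kb; case: ltnP => kl; rewrite tree_contractE tree_graft_nleaf ?andbF /=.
  rewrite IHl // tree_contract_notin //; apply/negP => /tree_qdes_bound.
  by rewrite nleaves_graft; lia.
rewrite (tree_contract_notin (u := l)).
  have -> : off + k = off + nleaves l + (k - nleaves l) by lia.
  by rewrite IHr //; lia.
by apply/negP => /tree_qdes_bound; lia.
Qed.

Lemma tree_contractK i off u : i \in tree_qdes off u ->
  tree_graft (i - off) (tree_contract i off u) = u.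
Proof.
elim: u off => // l IHl r IHr off; rewrite tree_qdesE tree_contractE.
case: ifP => [/andP[/is_leafP -> /is_leafP ->]|_].
  by rewrite inE eq_sym => ->.
rewrite mem_cat /=.
have [il _|il /= ir] := boolP (i \in tree_qdes off l); last first.
  have := tree_qdes_bound ir; rewrite (tree_contract_notin il) => b.
  rewrite ifF; last by lia.
  by rewrite -subnDA IHr.
have b := tree_qdes_bound il; rewrite ifT; last first.
  by have := nleaves_contract il; lia.
rewrite IHl // (tree_contract_notin (u := r)) //.
by apply/negP => /tree_qdes_bound; lia.
Qed.

Lemma mem_qdes_node q off l r :
  (q \in tree_qdes off l) || (q \in tree_qdes (off + nleaves l) r) ->
  q \in tree_qdes off (Node l r).
Proof. by rewrite tree_qdesE -mem_cat; case: l r => [|? ?] []. Qed.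

Lemma tree_qdes_shift q off u : q \in tree_qdes off.+1 u -> q.-1 \in tree_qdes off u.
Proof.
elim: u off => // l IHl r IHr off; rewrite !tree_qdesE.
case: ifP => _; first by rewrite !inE => /eqP ->.
by rewrite !mem_cat addSn => /orP[/IHl ->|/IHr ->]; rewrite ?orbT.
Qed.

(** Grafting raises by one the descents to the right of the new node. Each of these would come from
    an old descent beyond [off + k], which the hypothesis excludes. *)
Lemma tree_qdes_graft_le k off u : k < nleaves u ->
  {in tree_qdes off u, forall q, q <= off + k} ->
  {in tree_qdes off (tree_graft k u), forall q, q <= off + k}.
Proof.
elim: u k off => [|l IHl r IHr] k off /=.
  by move=> _ _ q; rewrite inE => /eqP ->; lia.
move=> kb le_k; have le_l : {in tree_qdes off l, forall q, q <= off + k}.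
  by move=> q ql; apply/le_k/mem_qdes_node; rewrite ql.
have le_r : {in tree_qdes (off + nleaves l) r, forall q, q <= off + k}.
  by move=> q qr; apply/le_k/mem_qdes_node; rewrite qr orbT.
case: ltnP => kl q; rewrite tree_qdesE tree_graft_nleaf ?andbF /= mem_cat.
  case/orP => [|qr]; first exact: IHl.
  rewrite nleaves_graft addnS in qr.
  have qr' := tree_qdes_shift qr.
  by have := le_r _ qr'; have := tree_qdes_bound qr'; lia.
case/orP => [/le_l //|]; have -> : off + k = off + nleaves l + (k - nleaves l) by lia.
by apply: IHr => [|q' /le_r]; lia.
Qed.

Lemma seq_qdes_bound off s q : q \in seq_qdes off s -> off <= q.
Proof.
elim: s off => //= u s IH off; rewrite mem_cat.
by case/orP => [/tree_qdes_bound|/IH]; lia.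
Qed.

Lemma seq_qdes_shift q off s : q \in seq_qdes off.+1 s -> q.-1 \in seq_qdes off s.
Proof.
elim: s off => // u s IH off /=; rewrite !mem_cat addSn.
by case/orP => [/tree_qdes_shift ->|/IH ->]; rewrite ?orbT.
Qed.

Lemma seq_contract_notin i off s :
  i \notin seq_qdes off s -> seq_contract i off s = s.
Proof.
elim: s off => //= u s IH off; rewrite mem_cat negb_or.
by case/andP => iu /IH ->; rewrite tree_contract_notin.
Qed.

Lemma mem_seq_qdes_graft k off s : off + k \in seq_qdes off (seq_graft k s).
Proof.
elim: s k off => [|u s IH] k off /=.
  elim: k off => [|k IH] off /=; first by rewrite addn0 inE.
  by rewrite addnS addn1 -addSn.
case: ltnP => ku /=; rewrite mem_cat ?mem_qdes_graft //.
have -> : off + k = off + nleaves u + (k - nleaves u) by lia.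
by rewrite IH orbT.
Qed.

Lemma seq_qdes_graft_le k off s :
  {in seq_qdes off s, forall q, q <= off + k} ->
  {in seq_qdes off (seq_graft k s), forall q, q <= off + k}.
Proof.
elim: s k off => [|u s IH] k off /= le_k.
  move=> q; elim: k off {le_k} => [|k IH] off /=; first by rewrite inE => /eqP ->; lia.
  by rewrite addn1 => /IH; lia.
have le_u : {in tree_qdes off u, forall q, q <= off + k}.
  by move=> q qu; apply: le_k; rewrite mem_cat qu.
have le_s : {in seq_qdes (off + nleaves u) s, forall q, q <= off + k}.
  by move=> q qs; apply: le_k; rewrite mem_cat qs orbT.
case: ltnP => ku q /=; rewrite mem_cat => /orP[].
- exact: tree_qdes_graft_le.
- rewrite nleaves_graft addnS => /seq_qdes_shift qs.
  by have := le_s _ qs; have := seq_qdes_bound qs; lia.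
- exact: le_u.
- have -> : off + k = off + nleaves u + (k - nleaves u) by lia.
  by apply: IH => q' /le_s; lia.
Qed.

Lemma strip_nil_qdes off s : strip s = [::] -> seq_qdes off s = [::].
Proof.
elim: s off => //= u s IH off; case: eqP => [e|] //=.
by case: u => //= _; rewrite IH.
Qed.

Lemma seq_qdes_strip off s : seq_qdes off (strip s) = seq_qdes off s.
Proof.
elim: s off => //= u s IH off; case: eqP => [e|_] /=; last by rewrite IH.
by case: u => [|l r] /=; rewrite ?e ?strip_nil_qdes.
Qed.

Lemma strip_idem s : strip (strip s) = strip s.
Proof.
elim: s => //= u s IH; case: ifP => //= /negbT ne; rewrite IH.
by rewrite (negbTE ne).
Qed.

Lemma strip_id s : normal_seq s -> strip s = s.
Proof.
elim: s => //= u [|v s] IH /=; first by case: u.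
by move=> /IH /= ->.
Qed.

Lemma strip_cons u s s' : strip s = strip s' -> strip (u :: s) = strip (u :: s').
Proof. by move=> /= ->. Qed.

Lemma strip_contract i off s :
  strip (seq_contract i off (strip s)) = strip (seq_contract i off s).
Proof.
elim: s off => //= u s IH off; case: ifP => [/andP[/eqP e lu]|_].
  by case: u lu => //= _; rewrite -IH e.
by apply: strip_cons; apply: IH.
Qed.

Lemma strip_graft k s : strip (seq_graft k (strip s)) = strip (seq_graft k s).
Proof.
elim: s k => //= u s IH k; case: ifP => [/andP[/eqP e lu]|_].
  case: u lu => // _; case: k => [|k] /=; first by rewrite e.
  by have := IH k; rewrite e subn1 /= => ->.
rewrite /=; case: ltnP => _; first by apply: strip_cons; rewrite strip_idem.
exact: strip_cons.
Qed.

(** Equality holds only up to [strip]: a graft beyond the end of the list leaves trivial trees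
    behind after contraction. *)
Lemma seq_graftK k off s :
  strip (seq_contract (off + k) off (seq_graft k s)) = strip s.
Proof.
elim: s k off => [|u s IH] k off.
  elim: k off => [|k IH] off /=; first by rewrite addn0 eqxx.
  by rewrite addnS addn1 -addSn IH.
rewrite [seq_graft _ _]/=; case: ltnP => ku; rewrite [seq_contract _ _ _]/=.
  rewrite tree_graftK // seq_contract_notin //; apply/negP => /seq_qdes_bound.
  by rewrite nleaves_graft; lia.
rewrite tree_contract_notin; last by apply/negP => /tree_qdes_bound; lia.
apply: strip_cons; have -> : off + k = off + nleaves u + (k - nleaves u) by lia.
exact: IH.
Qed.

Lemma seq_contractK i off s : i \in seq_qdes off s ->
  seq_graft (i - off) (seq_contract i off s) = s.
Proof.
elim: s off => //= u s IH off; rewrite mem_cat.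
have [iu _|iu /= is_] := boolP (i \in tree_qdes off u).
  have b := tree_qdes_bound iu; rewrite ifT; last first.
    by have := nleaves_contract iu; lia.
  rewrite tree_contractK // seq_contract_notin //.
  by apply/negP => /seq_qdes_bound; lia.
have b := seq_qdes_bound is_; rewrite tree_contract_notin // ifF; last by lia.
by rewrite -subnDA IH.
Qed.

Lemma sumn_size_strip s :
  sumn (map tree_size (strip s)) = sumn (map tree_size s).
Proof.
elim: s => //= u s <-; case: ifP => //= /andP[/eqP -> lu].
by case: u lu.
Qed.

Lemma sumn_size_graft k s :
  sumn (map tree_size (seq_graft k s)) = (sumn (map tree_size s)).+1.
Proof.
elim: s k => [|u s IH] k /=; first by elim: k.
by case: ifP => _ /=; rewrite ?tree_size_graft ?IH ?addnS.
Qed.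

Lemma tree_qdes_eq0 off u : (tree_qdes off u == [::]) = is_leaf u.
Proof.
elim: u off => // l IHl r IHr off; rewrite tree_qdesE.
case: ifP => // lr; rewrite -size_eq0 size_cat addn_eq0 !size_eq0.
by rewrite IHl IHr lr.
Qed.

Lemma val_mk_forest s : val (mk_forest s) = strip s. Proof. by []. Qed.

Lemma strip_val (F : forest) : strip (val F) = val F.
Proof. exact/strip_id/(valP F). Qed.

Lemma Qdes_eq0 (F : forest) : Qdes F = [::] -> F = forest_empty.
Proof.
move=> e; apply: val_inj => /=; rewrite -strip_val; move: e; rewrite /Qdes.
elim: (val F) 0 => //= u s IH off.
have := tree_qdes_eq0 off u; case: (tree_qdes off u) => //= /esym/is_leafP -> /IH ->.
by [].
Qed.

Lemma mem_Qdes_graft F i : i \in Qdes (graft F i).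
Proof. by rewrite /Qdes val_mk_forest seq_qdes_strip -{1}[i]add0n mem_seq_qdes_graft. Qed.

Lemma Qdes_graft_le F i :
  {in Qdes F, forall q, q <= i} -> {in Qdes (graft F i), forall q, q <= i}.
Proof.
move=> le_i; rewrite /Qdes val_mk_forest seq_qdes_strip.
exact: (@seq_qdes_graft_le i 0).
Qed.

Lemma graftK F i : fcontract (graft F i) i = F.
Proof.
by apply: val_inj; rewrite !val_mk_forest strip_contract (seq_graftK i 0) strip_val.
Qed.

Lemma fcontractK F i : i \in Qdes F -> graft (fcontract F i) i = F.
Proof.
move=> iF; apply: val_inj; rewrite !val_mk_forest strip_graft.
by rewrite -{1}[i]subn0 seq_contractK // strip_val.
Qed.

Lemma forest_size_graft F i : forest_size (graft F i) = (forest_size F).+1.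
Proof. by rewrite /forest_size val_mk_forest sumn_size_strip sumn_size_graft. Qed.

Lemma forest_size_fcontract F i : i \in Qdes F ->
  forest_size F = (forest_size (fcontract F i)).+1.
Proof. by move=> iF; rewrite -(forest_size_graft _ i) fcontractK. Qed.

Local Open Scope ring_scope.

(* [tau] lists the indices of the t-variables still present, so [skip i] is
   the passage from t to t-hat_i. *)
Definition skip (i : nat) (tau : nat -> nat) (k : nat) : nat :=
  if (k < i)%N then tau k else tau k.+1.

(* OpM and OpP stand for R^- and R^+. *)
Variant op := OpE | OpM | OpP.

Definition isE (a : op * nat) := if a.1 is OpE then true else false.

Definition skips (tau : nat -> nat) (w : seq (op * nat)) : nat -> nat :=
  foldl (fun tau a => skip a.2 tau) tau w.

Lemma eq_skip i tau tau' : tau =1 tau' -> skip i tau =1 skip i tau'.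
Proof. by move=> e k; rewrite /skip !e. Qed.

Lemma skip_lt i tau k : (k < i)%N -> skip i tau k = tau k.
Proof. by rewrite /skip => ->. Qed.

Lemma skip_ge i tau k : (i <= k)%N -> skip i tau k = tau k.+1.
Proof. by rewrite /skip ltnNge => ->. Qed.

(** Both sides delete the entries [j] and [i.+1] of [tau], so two words in commuted order continue
    with the same t-variables. *)
Lemma skip_skip i j tau : (j <= i)%N ->
  skip i (skip j tau) =1 skip j (skip i.+1 tau).
Proof.
move=> ji k; rewrite /skip.
by do ![case: ifP => ?]; rewrite ?addn0; try (congr tau); lia.
Qed.

Definition increasing (tau : nat -> nat) := forall i j, (i <= j)%N -> (tau i <= tau j)%N.

Lemma skip_increasing i tau : increasing tau -> increasing (skip i tau).
Proof. by move=> inc j k jk; rewrite /skip; do ![case: ifP => ?]; apply: inc; lia. Qed.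

Lemma skips_increasing w tau : increasing tau -> increasing (skips tau w).
Proof. by elim: w tau => //= a w IH tau inc; apply: IH; apply: skip_increasing. Qed.

(* Abstracts [xtpoly], whose concrete operations are expensive to compare up to
   conversion. *)
Section FreeRing.

Variables (R : comNzRingType) (x t : nat -> R).
Variable sub : (nat -> R) -> (nat -> R) -> {rmorphism R -> R}.
Hypothesis subx : forall a b i, sub a b (x i) = a i.
Hypothesis subt : forall a b i, sub a b (t i) = b i.
Hypothesis gen_ind : forall Q : R -> Prop,
  Q 1 -> (forall i, Q (x i)) -> (forall i, Q (t i)) -> (forall p, Q p -> Q (- p)) ->
  (forall p q, Q p -> Q q -> Q (p + q)) ->
  (forall p q, Q p -> Q q -> Q (p * q)) -> forall p, Q p.
Hypothesis xt_reg : forall i k (p q : R),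
  (x i - t k) * p = (x i - t k) * q -> p = q.

Lemma hom_eq (f g : {rmorphism R -> R}) :
  (forall i, f (x i) = g (x i)) -> (forall i, f (t i) = g (t i)) -> f =1 g.
Proof.
move=> fx ft; elim/gen_ind => // [|p fp|p q fp fq|p q fp fq].
- by rewrite !rmorph1.
- by rewrite !rmorphN fp.
- by rewrite !rmorphD fp fq.
- by rewrite !rmorphM fp fq.
Qed.

Lemma eq_sub a b a' b' : a =1 a' -> b =1 b' -> sub a b =1 sub a' b'.
Proof. by move=> ea eb; apply: hom_eq => i; rewrite ?subx ?subt. Qed.

Lemma sub_comp a b c d p :
  sub a b (sub c d p) = sub (sub a b \o c) (sub a b \o d) p.
Proof.
by apply: (@hom_eq (sub a b \o sub c d)) => i /=; rewrite ?subx ?subt.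
Qed.

Lemma sub_id p : sub x t p = p.
Proof. by apply: (@hom_eq (sub x t) idfun) => i; rewrite ?subx ?subt. Qed.

(** Membership in Z[t], expressed without monomials as invariance under every substitution for the
    x-variables. *)
Definition tconst (c : R) := forall a, sub a t c = c.

Lemma tconst_t k : tconst (t k). Proof. by move=> a; rewrite subt. Qed.
Lemma tconst1 : tconst 1. Proof. by move=> a; rewrite rmorph1. Qed.
Lemma tconstN p : tconst p -> tconst (- p).
Proof. by move=> cp a; rewrite rmorphN cp. Qed.
Lemma tconstB p q : tconst p -> tconst q -> tconst (p - q).
Proof. by move=> cp cq a; rewrite rmorphB cp cq. Qed.

(** * Insertion operators and divided differences *)

(* R_i^- is [ins i i], and R_i^+ is [ins i.+1 i]. *)
Definition ins (i k : nat) : {rmorphism R -> R} :=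
  sub (fun j => if (j < i)%N then x j else if j == i then t k else x j.-1) t.

Lemma ins_t i k l : ins i k (t l) = t l. Proof. exact: subt. Qed.

Lemma ins_xlt i k j : (j < i)%N -> ins i k (x j) = x j.
Proof. by move=> ji; rewrite subx ji. Qed.

Lemma ins_xeq i k : ins i k (x i) = t k.
Proof. by rewrite subx ltnn eqxx. Qed.

Lemma ins_xS i k j : (i <= j)%N -> ins i k (x j.+1) = x j.
Proof. by move=> ij; rewrite subx ltnNge leqW //= gtn_eqF. Qed.

Lemma ins_const c i k : tconst c -> ins i k c = c.
Proof. exact. Qed.

(** Both sides put [t a] at position [j] and [t b] at position [i.+1] of the argument list. *)
Lemma ins_ins i j a b p : (j <= i)%N ->
  ins i b (ins j a p) = ins j a (ins i.+1 b p).
Proof.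
move=> ji; apply: (@hom_eq (ins i b \o ins j a) (ins j a \o ins i.+1 b)) => k /=;
  last by rewrite !ins_t.
have [kj|] := ltnP k j.
  by rewrite !ins_xlt //; lia.
rewrite leq_eqVlt => /orP[/eqP <-|].
  by rewrite ins_xeq ins_t ins_xlt ?ins_xeq.
case: k => // k; rewrite ltnS => jk; rewrite ins_xS //.
have [ki|] := ltnP k i.
  by rewrite ins_xlt // ins_xlt // ins_xS.
rewrite leq_eqVlt => /orP[/eqP <-|].
  by rewrite !ins_xeq ins_t.
by case: k jk => // k jk ik; rewrite !ins_xS //; lia.
Qed.

(** The quotient is built by induction on generators, with the Leibniz rule for products. The
    boolean equality makes [xchoose] applicable, so no division in [R] is required. *)
Lemma dd_exists i k p : exists q, (x i - t k) * q == ins i.+1 k p - ins i k p.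
Proof.
elim/gen_ind: p => [|j|j|p [p' /eqP e]|p q [p' /eqP ep] [q' /eqP eq]
  |p q [p' /eqP ep] [q' /eqP eq]].
- by exists 0; rewrite !rmorph1 subrr mulr0.
- have [ji|] := ltnP j i.
    by exists 0; rewrite !ins_xlt ?subrr ?mulr0 //; lia.
  rewrite leq_eqVlt => /orP[/eqP <-|].
    by exists 1; rewrite ins_xlt // ins_xeq mulr1.
  case: j => // j; rewrite ltnS leq_eqVlt => /orP[/eqP <-|ij].
    by exists (-1); rewrite ins_xeq ins_xS // mulrN1 opprB.
  by exists 0; rewrite !ins_xS ?subrr ?mulr0 //; lia.
- by exists 0; rewrite !ins_t subrr mulr0.
- by exists (- p'); rewrite mulrN e !rmorphN opprB opprK addrC.
- by exists (p' + q'); rewrite mulrDr ep eq !rmorphD; apply/eqP; ring.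
- exists (p' * ins i.+1 k q + ins i k p * q').
  rewrite mulrDr mulrA ep mulrCA eq !rmorphM; apply/eqP; ring.
Qed.

Definition dd i k p := xchoose (dd_exists i k p).

Lemma ddE i k p : (x i - t k) * dd i k p = ins i.+1 k p - ins i k p.
Proof. exact/eqP/(xchooseP (dd_exists i k p)). Qed.

Lemma dd_uniq i k p q :
  (x i - t k) * q = ins i.+1 k p - ins i k p -> dd i k p = q.
Proof. by rewrite -ddE => /xt_reg. Qed.

Lemma dd_eq0 i k p : dd i k p = 0 <-> ins i.+1 k p = ins i k p.
Proof.
split=> [e|e]; last by apply: dd_uniq; rewrite e subrr mulr0.
by apply/eqP; rewrite -subr_eq0 -ddE e mulr0.
Qed.

Lemma ddD i k p q : dd i k (p + q) = dd i k p + dd i k q.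
Proof. by apply: dd_uniq; rewrite mulrDr !ddE !rmorphD; ring. Qed.

Lemma ddM i k p q :
  dd i k (p * q) = dd i k p * ins i.+1 k q + ins i k p * dd i k q.
Proof. by apply: dd_uniq; rewrite mulrDr mulrA ddE mulrCA ddE !rmorphM; ring. Qed.

Lemma dd_const i k c : tconst c -> dd i k c = 0.
Proof. by move=> cc; apply/dd_eq0; rewrite !ins_const. Qed.

Lemma dd0 i k : dd i k 0 = 0.
Proof. by apply/dd_eq0; rewrite !rmorph0. Qed.

Lemma ddZ i k c p : tconst c -> dd i k (c * p) = c * dd i k p.
Proof. by move=> cc; rewrite ddM dd_const // mul0r add0r ins_const. Qed.

Lemma ddN i k p : dd i k (- p) = - dd i k p.
Proof. by apply: dd_uniq; rewrite mulrN ddE !rmorphN; ring. Qed.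

(** An insertion is a ring morphism, so [ddE] can be carried through it. The cases [ins_dd_lt],
    [ins_dd_eq] and [ins_dd_gt] differ in the image of the x-variable of the linear factor: kept,
    replaced by [t a], or lowered by one. *)
Lemma ins_dd_lt i j a b p : (i < j)%N ->
  (x i - t b) * ins j a (dd i b p) = ins j a (ins i.+1 b p) - ins j a (ins i b p).
Proof. by move=> ij; rewrite -rmorphB -ddE rmorphM rmorphB /= ins_t ins_xlt. Qed.

Lemma ins_dd_eq i a b p :
  (t a - t b) * ins i a (dd i b p) = ins i a (ins i.+1 b p) - ins i a (ins i b p).
Proof. by rewrite -rmorphB -ddE rmorphM rmorphB /= ins_t ins_xeq. Qed.

Lemma ins_dd_gt i j a b p : (j <= i)%N ->
  (x i - t b) * ins j a (dd i.+1 b p) =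
  ins j a (ins i.+2 b p) - ins j a (ins i.+1 b p).
Proof. by move=> ji; rewrite -rmorphB -ddE rmorphM rmorphB /= ins_t ins_xS. Qed.

Lemma dd_ins_le i j a b p : (j <= i)%N ->
  dd i b (ins j a p) = ins j a (dd i.+1 b p).
Proof.
move=> ji; apply: dd_uniq; rewrite ins_dd_gt //.
by rewrite (@ins_ins i.+1 j) ?leqW // (@ins_ins i j).
Qed.

Lemma dd_ins_gt i j a b p : (i < j)%N ->
  dd i b (ins j.+1 a p) = ins j a (dd i b p).
Proof.
move=> ij; apply: dd_uniq; rewrite ins_dd_lt //.
by rewrite (@ins_ins j i.+1) // (@ins_ins j i) // ltnW.
Qed.

(** Write f(u, v, w) for [p] with these entries at positions i to i+2. The numerator f(x_i, t_a,
    t_b) - f(t_b, t_a, x_i) telescopes through f(t_a, x_i, t_b) and f(t_a, t_b, x_i). The last swap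
    exchanges t_a and t_b, whence the correction with coefficient t_b - t_a. *)
Lemma dd_ins_mid i a b p :
  dd i b (ins i.+1 a p) =
  ins i.+1 b (dd i a p) + ins i a (dd i.+1 b p) + (t b - t a) * dd i b (dd i a p).
Proof.
apply: dd_uniq.
(* Expanding the outer [dd i b] turns the factor x_i - t_b of [ins i.+1 b (dd i a p)] into x_i -
   t_a, the one that clears the inner difference. *)
transitivity ((x i - t a) * ins i.+1 b (dd i a p) - (t b - t a) * ins i b (dd i a p)
              + (x i - t b) * ins i a (dd i.+1 b p)).
  rewrite !mulrDr [(x i - t b) * ((t b - t a) * _)]mulrCA ddE; ring.
rewrite ins_dd_lt // ins_dd_eq ins_dd_gt //.
rewrite -(@ins_ins i.+1 i a b) // -(@ins_ins i i a b) //; ring.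
Qed.

(** The other telescoping, through f(x_i, t_b, t_a) and f(t_b, x_i, t_a), has the opposite
    coefficient. The order of [a] and [b] decides which form is Graham-positive: [evw_PE_eq] takes
    [dd_ins_mid], [evw_ME_eq] takes this one. *)
Lemma dd_ins_mid' i a b p :
  dd i b (ins i.+1 a p) =
  ins i.+1 a (dd i b p) + ins i b (dd i.+1 a p) + (t a - t b) * dd i b (dd i.+1 a p).
Proof.
apply: dd_uniq.
transitivity ((x i - t b) * ins i.+1 a (dd i b p) + (x i - t a) * ins i b (dd i.+1 a p)
              - (t b - t a) * ins i.+1 b (dd i.+1 a p)).
  rewrite !mulrDr [(x i - t b) * ((t a - t b) * _)]mulrCA ddE; ring.
rewrite ins_dd_lt // ins_dd_eq ins_dd_gt //.
rewrite -(@ins_ins i.+1 i b a) // -(@ins_ins i.+1 i.+1 b a) //; ring.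
Qed.

Lemma dd_dd i j a b p : (j < i)%N -> dd i b (dd j a p) = dd j a (dd i.+1 b p).
Proof.
move=> ji; apply: dd_uniq; apply: (@xt_reg j a).
rewrite mulrCA ddE !mulrBr !ins_dd_lt ?leqW // !ins_dd_gt ?(ltnW ji) //.
rewrite !(@ins_ins i.+1) ?(@ins_ins i j.+1) // ?(@ins_ins i j) //; try lia.
ring.
Qed.

(** * Words of operators *)

Definition act o i k p :=
  match o with OpE => dd i k p | OpM => ins i k p | OpP => ins i.+1 k p end.

(** Insertions consume their t-variable just as divided differences do; hence both factors in each
    term of the Leibniz rule continue with the same [tau]. *)
Fixpoint run tau (w : seq (op * nat)) p : R :=
  if w is (o, i) :: w' then run (skip i tau) w' (act o i (tau i) p) else p.

Definition ev (tau : nat -> nat) : {rmorphism R -> R} := sub (t \o tau) t.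

Definition evw tau w p := ev (skips tau w) (run tau w p).

Lemma ev_t tau k : ev tau (t k) = t k. Proof. exact: subt. Qed.
Lemma ev_x tau k : ev tau (x k) = t (tau k). Proof. exact: subx. Qed.

Lemma evw_cons tau o i w p :
  evw tau ((o, i) :: w) p = evw (skip i tau) w (act o i (tau i) p).
Proof. by []. Qed.

Lemma evw_cat tau u w p : evw tau (u ++ w) p = evw (skips tau u) w (run tau u p).
Proof. by elim: u tau p => //= -[o i] u IH tau p; rewrite !evw_cons IH. Qed.

Lemma eq_evw tau tau' w p : tau =1 tau' -> evw tau w p = evw tau' w p.
Proof.
elim: w tau tau' p => [|[o i] w IH] tau tau' p e.
  by apply: eq_sub => k //=; rewrite e.
by rewrite !evw_cons e; apply: IH; apply: eq_skip.
Qed.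

Lemma actD o i k p q : act o i k (p + q) = act o i k p + act o i k q.
Proof. by case: o; rewrite /= ?ddD ?rmorphD. Qed.

Lemma actZ o i k c p : tconst c -> act o i k (c * p) = c * act o i k p.
Proof.
by move=> cc; case: o => /=; [exact: ddZ | rewrite rmorphM (ins_const _ _ cc) ..].
Qed.

Lemma evwD tau w p q : evw tau w (p + q) = evw tau w p + evw tau w q.
Proof.
elim: w tau p q => [|[o i] w IH] tau p q; first exact: rmorphD.
by rewrite !evw_cons actD IH.
Qed.

Lemma evwZ tau w c p : tconst c -> evw tau w (c * p) = c * evw tau w p.
Proof.
move=> cc; elim: w tau p => [|[o i] w IH] tau p; last by rewrite !evw_cons actZ ?IH.
by rewrite /evw /= rmorphM /= cc.
Qed.

Lemma evw0 tau w : evw tau w 0 = 0.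
Proof. by rewrite -(mul0r 0) evwZ ?mul0r // => a; rewrite rmorph0. Qed.

Lemma evw_sum (I : Type) (r : seq I) (F : I -> R) tau w :
  evw tau w (\sum_(i <- r) F i) = \sum_(i <- r) evw tau w (F i).
Proof. by apply: (big_morph _ (evwD tau w) (evw0 tau w)). Qed.

(** The insertion puts back at position [j] exactly the variable that [skip j] deletes. *)
Lemma evw_M tau j p : evw tau [:: (OpM, j)] p = evw tau [::] p.
Proof.
apply: (@hom_eq (ev (skip j tau) \o ins j (tau j)) (ev tau)) => k /=;
  last by rewrite ins_t !ev_t.
have [kj|] := ltnP k j; first by rewrite ins_xlt // !ev_x /skip kj.
rewrite leq_eqVlt => /orP[/eqP <-|]; first by rewrite ins_xeq ev_t ev_x.
case: k => // k; rewrite ltnS => jk.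
by rewrite ins_xS // !ev_x /skip ltnNge jk.
Qed.

Lemma evw_P tau j p : evw tau [:: (OpP, j)] p =
  evw tau [::] p + (t (tau j.+1) - t (tau j)) * evw tau [:: (OpE, j)] p.
Proof.
rewrite -(evw_M tau j) /evw /=.
(* Once entry [j] is deleted, x_j is evaluated at the next one, [tau j.+1]. *)
have -> : t (tau j.+1) - t (tau j) = ev (skip j tau) (x j - t (tau j)).
  by rewrite rmorphB /= ev_x ev_t /skip ltnn.
by rewrite -rmorphM ddE -rmorphD /= addrC subrK.
Qed.

(** The leftmost letter acts first. The six rules from here to [evw_PE_eq] cover all [i] and [j] and
    move an insertion to the right of a divided difference. A correction arises only for insertion
    position [i.+1], that is [j = i.+1] for [OpM] and [j = i] for [OpP]. *)
Lemma evw_ME_le tau i j w p : (j <= i)%N ->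
  evw tau ((OpM, j) :: (OpE, i) :: w) p = evw tau ((OpE, i.+1) :: (OpM, j) :: w) p.
Proof.
move=> ji; rewrite !evw_cons /= (eq_evw _ _ (skip_skip _ ji)).
by rewrite skip_ge // skip_lt // dd_ins_le.
Qed.

Lemma evw_PE_lt tau i j w p : (j < i)%N ->
  evw tau ((OpP, j) :: (OpE, i) :: w) p = evw tau ((OpE, i.+1) :: (OpP, j) :: w) p.
Proof.
move=> ji; have ji' := ltnW ji.
rewrite !evw_cons /= (eq_evw _ _ (skip_skip _ ji')).
by rewrite skip_ge // skip_lt ?leqW // dd_ins_le.
Qed.

Lemma evw_ME_gt tau i j w p : (i < j)%N ->
  evw tau ((OpM, j.+1) :: (OpE, i) :: w) p = evw tau ((OpE, i) :: (OpM, j) :: w) p.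
Proof.
move=> ij; have ij' := ltnW ij.
rewrite !evw_cons /= -(eq_evw _ _ (skip_skip _ ij')).
by rewrite skip_lt // skip_ge // dd_ins_gt.
Qed.

Lemma evw_PE_gt tau i j w p : (i <= j)%N ->
  evw tau ((OpP, j.+1) :: (OpE, i) :: w) p = evw tau ((OpE, i) :: (OpP, j) :: w) p.
Proof.
move=> ij; rewrite !evw_cons /= -(eq_evw _ _ (skip_skip _ ij)).
by rewrite skip_lt // skip_ge // dd_ins_gt.
Qed.

Lemma evw_ME_eq tau i w p :
  evw tau ((OpM, i.+1) :: (OpE, i) :: w) p =
  evw tau ((OpE, i) :: (OpP, i) :: w) p + evw tau ((OpE, i.+1) :: (OpM, i) :: w) p
  + (t (tau i.+1) - t (tau i)) * evw tau ((OpE, i.+1) :: (OpE, i) :: w) p.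
Proof.
rewrite !evw_cons /= (eq_evw _ _ (skip_skip tau (leqnn i))).
rewrite (skip_ge _ (leqnn i)) (skip_lt _ (ltnSn i)) -evwZ;
  last by apply: tconstB; exact: tconst_t.
by rewrite -!evwD -dd_ins_mid'.
Qed.

Lemma evw_PE_eq tau i w p :
  evw tau ((OpP, i) :: (OpE, i) :: w) p =
  evw tau ((OpE, i) :: (OpP, i) :: w) p + evw tau ((OpE, i.+1) :: (OpM, i) :: w) p
  + (t (tau i.+1) - t (tau i)) * evw tau ((OpE, i) :: (OpE, i) :: w) p.
Proof.
rewrite !evw_cons /= -(eq_evw _ _ (skip_skip tau (leqnn i))).
rewrite (skip_ge _ (leqnn i)) (skip_lt _ (ltnSn i)) -evwZ;
  last by apply: tconstB; exact: tconst_t.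
by rewrite -!evwD -dd_ins_mid.
Qed.

(** * Nilpotency and spanning *)

Lemma fin_support p : exists N, forall M a, (N <= M)%N ->
  sub (fun k => if (k < M)%N then x k else a k) t p = p.
Proof.
elim/gen_ind: p => [|i|i|p [N e]|p q [N e] [N' e']|p q [N e] [N' e']].
- by exists 0%N => M a _; rewrite rmorph1.
- by exists i.+1 => M a iM; rewrite subx iM.
- by exists 0%N => M a _; rewrite subt.
- by exists N => M a NM; rewrite rmorphN e.
- by exists (maxn N N') => M a; rewrite geq_max => /andP[? ?]; rewrite rmorphD e ?e'.
- by exists (maxn N N') => M a; rewrite geq_max => /andP[? ?]; rewrite rmorphM e ?e'.
Qed.

Lemma dd_fin_support p : exists N, forall i k, (N <= i)%N -> dd i k p = 0.
Proof.
have [N e] := fin_support p; exists N => i k Ni.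
by apply/dd_eq0; rewrite /ins !e // leqW.
Qed.

(** Starting beyond the x-support, x_N is replaced by [t (tau N)] for decreasing [N]. Each
    replacement leaves [p] fixed because the difference at [N] vanishes. *)
Lemma ev_of_dd0 tau p : (forall i, dd i (tau i) p = 0) -> ev tau p = p.
Proof.
move=> p0; pose U N := sub (fun k => if (k < N)%N then x k else t (tau k)) t.
suff UE N : U N p = p by rewrite -[RHS](UE 0); apply: eq_sub.
have [N0 /(_ _ (t \o tau) (leq_addl N _)) e] := fin_support p.
elim: N0 N e => [|M IH] N; first by rewrite addn0.
rewrite addnS => e; apply: IH; move: (N + M)%N e => {}N e.
have /dd_eq0 eqN := p0 N.
have -> : U N p = ins N (tau N) (U N.+1 p).
  rewrite /U sub_comp; apply: eq_sub => k /=; last by rewrite ins_t.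
  rewrite ltnS; case: (ltngtP k N) => [kN|kN|->].
  - by rewrite ins_xlt.
  - by rewrite ins_t.
  - by rewrite ins_xeq.
(* As [p] equals [U N.+1 p], it contains no x_k with k > N, so [ins N.+1] fixes it. *)
rewrite e -eqN -[in LHS]e -[RHS]e.
rewrite /U sub_comp; apply: eq_sub => k /=; last by rewrite ins_t.
by case: ifP => kN; rewrite ?ins_t ?ins_xlt.
Qed.

(** The t-index [k] is arbitrary and not tied to a [tau], which makes the notion stable under
    insertions and products without tracking deleted variables. *)
Fixpoint ddnil d p : Prop :=
  if d is d'.+1 then forall i k, ddnil d' (dd i k p) else p = 0.

Lemma ddnil0 d : ddnil d 0.
Proof. by elim: d => //= d IH i k; rewrite dd0. Qed.

Lemma ddnilS d p : ddnil d p -> ddnil d.+1 p.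
Proof.
elim: d p => [p -> i k|d IH p np i k]; first by rewrite dd0.
by apply: IH; apply: np.
Qed.

Lemma ddnil_le d e p : (d <= e)%N -> ddnil d p -> ddnil e p.
Proof.
move=> /subnK <-; elim: (e - d)%N => // n IH np.
by rewrite addSn; apply/ddnilS/IH.
Qed.

Lemma ddnilD d p q : ddnil d p -> ddnil d q -> ddnil d (p + q).
Proof.
elim: d p q => [p q -> ->|d IH p q np nq i k]; first exact: addr0.
by rewrite ddD; apply: IH.
Qed.

Lemma ddnilZ d c p : tconst c -> ddnil d p -> ddnil d (c * p).
Proof.
move=> cc; elim: d p => [p ->|d IH p np i k]; first exact: mulr0.
by rewrite ddZ //; apply: IH.
Qed.

Lemma ddnil_dd d i k p : ddnil d p -> ddnil d (dd i k p).
Proof. by case: d => [->|d np]; [exact: dd0 | exact/ddnilS]. Qed.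

Lemma ddnil_ins d j a p : ddnil d p -> ddnil d (ins j a p).
Proof.
elim: d j a p => [j a p ->|d IH j a p np i b]; first exact: rmorph0.
have [ji|] := leqP j i; first by rewrite dd_ins_le //; apply: IH.
case: j => // j; rewrite ltnS leq_eqVlt => /orP[/eqP <-|ij]; last first.
  by rewrite dd_ins_gt //; apply: IH.
rewrite dd_ins_mid; apply: ddnilD; first by apply: ddnilD; apply: IH.
apply: ddnilZ; first by apply: tconstB; apply: tconst_t.
exact: ddnil_dd.
Qed.

(** In each Leibniz term the difference lowers the order of one factor, and by [ddnil_ins] the
    insertion preserves that of the other. *)
Lemma ddnilM d e p q : ddnil d p -> ddnil e q -> ddnil (d + e) (p * q).
Proof.
have [n] := ubnP (d + e); elim: n d e p q => // n IH [|d] [|e] p q de np nq.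
- by rewrite np mul0r; apply: ddnil0.
- by rewrite np mul0r; apply: ddnil0.
- by rewrite nq mulr0; apply: ddnil0.
rewrite addSn => i k; rewrite ddM; apply: ddnilD.
  by apply: IH; [lia | exact: np | exact: ddnil_ins].
apply: (@ddnil_le (d.+1 + e)); first by lia.
by apply: IH; [lia | exact: ddnil_ins | exact: nq].
Qed.

Lemma ddnil_exists p : exists d, ddnil d p.
Proof.
elim/gen_ind: p => [|j|j|p [d np]|p q [d np] [e nq]|p q [d np] [e nq]].
- by exists 1%N => i k; apply: dd_const; apply: tconst1.
(* A first difference of a variable is 0, 1 or -1, and a second one kills it. *)
- exists 2%N => i k; have [ji|] := ltnP j i.
    have -> : dd i k (x j) = 0 by apply/dd_eq0; rewrite !ins_xlt // leqW.
    exact: (ddnil0 1).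
  rewrite leq_eqVlt => /orP[/eqP <-|].
    have -> : dd i k (x i) = 1 by apply: dd_uniq; rewrite ins_xlt // ins_xeq mulr1.
    by move=> i' k'; apply: dd_const; apply: tconst1.
  case: j => // j; rewrite ltnS leq_eqVlt => /orP[/eqP <-|ij].
    have -> : dd i k (x i.+1) = -1.
      by apply: dd_uniq; rewrite ins_xeq ins_xS // mulrN1 opprB.
    by move=> i' k'; apply: dd_const; apply: tconstN; apply: tconst1.
  have -> : dd i k (x j.+1) = 0 by apply/dd_eq0; rewrite !ins_xS // ltnW.
  exact: (ddnil0 1).
- by exists 1%N => i k; apply: dd_const; apply: tconst_t.
- by exists d; rewrite -mulN1r; apply: ddnilZ => //; apply: tconstN; apply: tconst1.
- exists (maxn d e); apply: ddnilD.
    by apply: ddnil_le np; rewrite leq_maxl.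
  by apply: ddnil_le nq; rewrite leq_maxr.
- by exists (d + e)%N; apply: ddnilM.
Qed.

(** * Change of t-variables along an index sequence *)

Definition relabel (tau : nat -> nat) : {rmorphism R -> R} := sub x (t \o tau).

Lemma relabel_ins tau i k p : relabel tau (ins i k p) = ins i (tau k) (relabel tau p).
Proof.
apply: (@hom_eq (relabel tau \o ins i k) (ins i (tau k) \o relabel tau)) => j /=;
  last by rewrite ins_t /relabel !subt.
rewrite /relabel /ins !subx.
by do ![case: ifP => _]; rewrite ?subx ?subt.
Qed.

Lemma relabel_dd tau i p : dd i (tau i) (relabel tau p) = relabel tau (dd i i p).
Proof.
apply: dd_uniq; rewrite -!relabel_ins -rmorphB -ddE rmorphM rmorphB /=.
by rewrite /relabel subx subt.
Qed.

Lemma relabel_skip tau i p :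
  relabel tau (sub x (t \o skip i id) p) = relabel (skip i tau) p.
Proof.
rewrite /relabel sub_comp; apply: eq_sub => k /=; first by rewrite subx.
by rewrite subt /= /skip; case: ifP.
Qed.

Lemma ev_relabel tau p : ev tau (relabel tau p) = relabel tau (ev id p).
Proof.
rewrite /ev /relabel !sub_comp; apply: eq_sub => k /=.
  by rewrite subx subt.
by rewrite !subt.
Qed.

(** * Dual words and spanning for a forest family *)

Section Family.

Variable P : forest -> R.
Hypothesis P_ev : forall F, ev id (P F) = (F == forest_empty)%:R.
Hypothesis P_dd : forall F i, dd i i (P F) =
  if i \in Qdes F then sub x (t \o skip i id) (P (fcontract F i)) else 0.

Let Pt tau F := relabel tau (P F).

Lemma dd_P tau F i : dd i (tau i) (Pt tau F) =
  if i \in Qdes F then Pt (skip i tau) (fcontract F i) else 0.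
Proof.
rewrite relabel_dd P_dd; case: ifP => _; last exact: rmorph0.
exact: relabel_skip.
Qed.

Lemma ev_P tau F : ev tau (Pt tau F) = (F == forest_empty)%:R.
Proof. by rewrite ev_relabel P_ev rmorph_nat. Qed.

Lemma P_empty tau : Pt tau forest_empty = 1.
Proof.
rewrite -[LHS](@ev_of_dd0 tau) => [|i]; first by rewrite ev_P eqxx.
by rewrite dd_P.
Qed.

(** The word contracts one descent of [H] at a time. Contraction at [i] is injective on forests with
    descent [i], so [K] survives down to the empty forest only if it is [H]. *)
Lemma dual_word H : exists w, all isE w /\
  forall tau K, evw tau w (Pt tau K) = (H == K)%:R.
Proof.
have [n] := ubnP (forest_size H); elim: n H => // n IH H Hn.
case E: (Qdes H) => [|i s].
  exists [::]; split=> // tau K.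
  by rewrite (Qdes_eq0 E) eq_sym; exact: ev_P.
have iH : i \in Qdes H by rewrite E mem_head.
have [|w [wE wP]] := IH (fcontract H i).
  by move: Hn; rewrite (forest_size_fcontract iH).
exists ((OpE, i) :: w); split=> // tau K; rewrite evw_cons /= dd_P.
case: ifP => iK; last first.
  by rewrite evw0; case: eqP => // e; rewrite e iK in iH.
rewrite wP; congr (nat_of_bool _)%:R; apply/eqP/eqP => [e|-> //].
by rewrite -(fcontractK iH) e fcontractK.
Qed.

(** By [dd_P] the differences of [Pt tau F] are known only at the t-variables that [tau] prescribes;
    this weaker form of [ddnil] asks for no others. *)
Fixpoint ddnilt tau d p : Prop :=
  if d is d'.+1 then forall i, ddnilt (skip i tau) d' (dd i (tau i) p) else p = 0.

Lemma ddnil_ddnilt tau d p : ddnil d p -> ddnilt tau d p.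
Proof. by elim: d tau p => //= d IH tau p np i; apply: IH. Qed.

Lemma ddniltD tau d p q : ddnilt tau d p -> ddnilt tau d q -> ddnilt tau d (p + q).
Proof.
elim: d tau p q => [tau p q -> ->|d IH tau p q np nq i]; first exact: addr0.
by rewrite ddD; apply: IH.
Qed.

Lemma ddniltZ tau d c p : tconst c -> ddnilt tau d p -> ddnilt tau d (c * p).
Proof.
move=> cc; elim: d tau p => [tau p ->|d IH tau p np i]; first exact: mulr0.
by rewrite ddZ //; apply: IH.
Qed.

Lemma ddnilt0 tau d : ddnilt tau d 0.
Proof. exact/ddnil_ddnilt/ddnil0. Qed.

Lemma ddnilt_P tau d F : (forest_size F < d)%N -> ddnilt tau d (Pt tau F).
Proof.
elim: d tau F => // d IH tau F Fd i; rewrite dd_P.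
case: ifP => iF; last exact: ddnilt0.
by apply: IH; move: Fd; rewrite (forest_size_fcontract iF).
Qed.

Lemma dd_sum (I : Type) (r : seq I) (F : I -> R) i k :
  dd i k (\sum_(a <- r) F a) = \sum_(a <- r) dd i k (F a).
Proof. exact: (big_morph _ (ddD i k) (dd0 i k)). Qed.

(* Peels off the largest index N at which p has a nonzero divided difference:
   grafting at N an expansion of that difference matches it, and creates no
   divided difference at a larger index. *)
Lemma spanning d N tau p :
  ddnilt tau d p -> (forall i, (N <= i)%N -> dd i (tau i) p = 0) ->
  exists2 s : seq (R * forest),
    {in s, forall a, [/\ tconst a.1, (forest_size a.2 < d)%N &
                        {in Qdes a.2, forall q, (q < N)%N}]} &
    p = \sum_(a <- s) a.1 * Pt tau a.2.
Proof.
elim: d N tau p => [N tau p -> _|d IHd N tau].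
  by exists [::]; rewrite ?big_nil.
elim: N => [p np p0|N IHN p np p0].
  (* For [N = 0] all differences vanish, so [p] lies in Z[t] and is a multiple of the polynomial 1
     of the empty forest. *)
  have e : ev tau p = p by apply: ev_of_dd0 => i; apply: p0.
  exists [:: (p, forest_empty)].
    move=> a; rewrite inE => /eqP -> /=; split=> // b.
    rewrite -[in LHS]e -[RHS]e /ev sub_comp; apply: eq_sub => k /=; exact: subt.
  by rewrite big_seq1 /= P_empty mulr1.
(* By [dd_dd], the differences of [dd N (tau N) p] beyond [N] come from those of [p], hence vanish.
   The bound [N.+1] keeps the descents in the expansion at most [N], as [Qdes_graft_le] requires. *)
have [|s sP sE] := IHd N.+1 (skip N tau) _ (np N).
  move=> i Ni; rewrite skip_ge 1?ltnW // dd_dd // p0 ?dd0 //; lia.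
pose r := \sum_(a <- s) a.1 * Pt tau (graft a.2 N).
(* Contracting a graft at [N] recovers the forest, so [r] has the same difference at [N] as [p];
   beyond [N] neither has any. *)
have [||s' s'P s'E] := IHN (p - r).
- apply: ddniltD => //; rewrite -mulN1r; apply: ddniltZ.
    exact/tconstN/tconst1.
  rewrite /r big_seq; apply: (big_ind (ddnilt tau d.+1)); first exact: ddnilt0.
    exact: ddniltD.
  move=> a /sP[ca sa _]; apply: ddniltZ => //; apply: ddnilt_P.
  by rewrite forest_size_graft.
- move=> i; rewrite ddD ddN dd_sum leq_eqVlt => /orP[/eqP <-|Ni].
    apply/eqP; rewrite subr_eq0 sE; apply/eqP; apply: eq_big_seq => a /sP[ca _ _].
    by rewrite ddZ // dd_P mem_Qdes_graft graftK.
  rewrite p0 // big_seq big1 ?subrr // => a /sP[ca _ qa]; rewrite ddZ // dd_P.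
  rewrite ifF ?mulr0 //; apply/negP => /(Qdes_graft_le qa).
  by rewrite leqNgt Ni.
exists ([seq (a.1, graft a.2 N) | a <- s] ++ s').
  move=> a; rewrite mem_cat => /orP[/mapP[b /sP[cb sb qb] ->]|/s'P[ca sa qa]] /=.
    split=> //; first by rewrite forest_size_graft.
    by move=> q /(Qdes_graft_le qb).
  by split=> // q /qa /ltnW.
by rewrite big_cat big_map /= -s'E addrC subrK.
Qed.

Lemma relabel_id p : relabel id p = p.
Proof. by rewrite -[RHS]sub_id; apply: eq_sub. Qed.

Lemma expansion_exists p : exists (S : seq forest) (c : forest -> R),
  [/\ uniq S, forall H, H \notin S -> c H = 0, forall H, tconst (c H) &
      p = \sum_(H <- S) c H * P H].
Proof.
have [d /(@ddnil_ddnilt id) np] := ddnil_exists p.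
have [N p0] := dd_fin_support p.
have [i Ni|s sP sE] := spanning np (N := N); first exact: p0.
(* A forest may occur several times in [s]; its coefficients are collected. *)
exists (undup (map snd s)), (fun H => \sum_(a <- s | a.2 == H) a.1); split.
- exact: undup_uniq.
- move=> H; rewrite mem_undup => /mapP Hs; rewrite big_seq_cond big1 // => a.
  by case/andP=> sa /eqP aH; case: Hs; exists a.
- move=> H b; rewrite rmorph_sum big_seq_cond [RHS]big_seq_cond.
  by apply: eq_bigr => a /andP[/sP[ca _ _] _].
transitivity (\sum_(a <- s) \sum_(H <- undup (map snd s) | H == a.2) a.1 * P H).
  rewrite {1}sE; apply: eq_big_seq => a sa; rewrite -big_filter.
  rewrite filter_pred1_uniq ?undup_uniq ?mem_undup ?map_f //.
  by rewrite big_seq1 /Pt relabel_id.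
rewrite (exchange_big_dep xpredT) //=; apply: eq_bigr => H _.
rewrite mulr_suml; apply: eq_bigl => a; exact: eq_sym.
Qed.

(** * Positivity *)

Variable pos : R -> Prop.
Hypothesis pos_nat : forall n, pos n%:R.
Hypothesis pos_step : forall i, pos (t i.+1 - t i).
Hypothesis posD : forall p q, pos p -> pos q -> pos (p + q).
Hypothesis posM : forall p q, pos p -> pos q -> pos (p * q).

Lemma pos0 : pos 0. Proof. exact: (pos_nat 0). Qed.

Lemma pos_tB i j : (i <= j)%N -> pos (t j - t i).
Proof.
move=> /subnK <-; elim: (j - i)%N => [|n IH]; first by rewrite subrr; apply: pos0.
rewrite addSn (_ : _ - _ = (t (n + i).+1 - t (n + i)%N) + (t (n + i)%N - t i)).
  exact: posD.
by ring.
Qed.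

Lemma evw_E_pos w tau F : all isE w -> pos (evw tau w (Pt tau F)).
Proof.
elim: w tau F => [|[[] i] w IH] //= tau F wE.
  by rewrite /evw /= ev_P; apply: pos_nat.
rewrite evw_cons /= dd_P; case: ifP => _; first exact: IH.
by rewrite evw0; apply: pos0.
Qed.

Lemma last_nonE n w : count (predC isE) w = n.+1 ->
  exists u a es, [/\ w = u ++ a :: es, ~~ isE a, all isE es &
                     count (predC isE) u = n].
Proof.
elim: w n => //= a w IH n; case E: (count (predC isE) w) => [|m].
  case Ea: (isE a) => //= -[<-]; exists [::], a, w; split; rewrite ?Ea //.
  by rewrite all_count -(count_predC isE) E addn0.
have [u [b [es [-> bE esE uE]]]] := IH _ E.
by rewrite /= addnS => -[<-]; exists (a :: u), b, es; split; rewrite //= uE.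
Qed.

(* The last insertion is pushed through the divided differences following it, up
   to the final evaluation, which absorbs it. *)
Lemma evw_pos_push n tau p es u o j : increasing tau ->
  (forall w, count (predC isE) w = n -> pos (evw tau w p)) ->
  ~~ isE (o, j) -> all isE es -> count (predC isE) u = n ->
  pos (evw tau (u ++ (o, j) :: es) p).
Proof.
move=> inc IHn; have pos_t v i : pos (t (skips tau v i.+1) - t (skips tau v i)).
  by apply/pos_tB/skips_increasing.
elim: es u o j => [|[[] i] es IH] u o j oE // esE un.
  case: o oE => // _; rewrite evw_cat.
    by rewrite evw_M -evw_cat cats0; apply: IHn.
  rewrite evw_P -!evw_cat cats0; apply: (posD (IHn _ un)).
  by apply: (posM (pos_t _ _)); apply: IHn; rewrite count_cat un /= !addn0.
(* Moving the divided difference into [u] keeps the number of insertions there and shortens [es]. *)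
have push i' o' j' : ~~ isE (o', j') ->
    pos (evw tau (u ++ (OpE, i') :: (o', j') :: es) p).
  move=> oE'; rewrite -cat_rcons; apply: IH => //.
  by rewrite -cats1 count_cat un /= !addn0.
(* A correction term has traded the insertion for a second divided difference, so only the [n]
   insertions of [u] remain. *)
have drop2 i' j' : pos (evw tau (u ++ (OpE, i') :: (OpE, j') :: es) p).
  apply: IHn; rewrite count_cat un /= !add0n -[RHS]addn0; congr addn.
  by apply/eqP; rewrite -leqn0 leqNgt -has_count has_predC negbK.
have add3 c p1 p2 p3 : pos c -> pos p1 -> pos p2 -> pos p3 -> pos (p1 + p2 + c * p3).
  by move=> pc pp1 pp2 pp3; apply: posD (posM pc pp3); apply: posD.
rewrite evw_cat; case: o oE => // _.
  have [ji|] := leqP j i; first by rewrite evw_ME_le // -evw_cat; apply: push.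
  case: j => // j; rewrite ltnS leq_eqVlt => /orP[/eqP <-|ij]; last first.
    by rewrite evw_ME_gt // -evw_cat; apply: push.
  by rewrite evw_ME_eq -!evw_cat; apply: add3;
    [exact: pos_t | exact: push | exact: push | exact: drop2].
have [ji|] := ltnP j i; first by rewrite evw_PE_lt // -evw_cat; apply: push.
rewrite leq_eqVlt => /orP[/eqP <-|].
  by rewrite evw_PE_eq -!evw_cat; apply: add3;
    [exact: pos_t | exact: push | exact: push | exact: drop2].
by case: j => // j ij; rewrite evw_PE_gt // -evw_cat; apply: push.
Qed.

Lemma evw_P_pos w tau F : increasing tau -> pos (evw tau w (Pt tau F)).
Proof.
move=> inc; have [n] := ubnP (count (predC isE) w); elim: n w => // n IHn w.
case E: (count (predC isE) w) => [|m] wn.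
  by apply: evw_E_pos; rewrite all_count -(count_predC isE) E addn0.
have [u [[o j] [es [-> oE esE um]]]] := last_nonE E.
apply: (evw_pos_push inc (n := m)) => // v vm; apply: IHn.
by rewrite vm.
Qed.

(** Although [w] has only divided differences, the Leibniz rule puts insertions on the factors;
    hence positivity is assumed for all words [u]. *)
Lemma evw_mul_pos w tau p q : all isE w ->
  (forall u, pos (evw tau u p)) -> (forall u, pos (evw tau u q)) ->
  pos (evw tau w (p * q)).
Proof.
elim: w tau p q => [|[[] i] w IH] tau p q //= wE pp pq.
  by rewrite /evw /= rmorphM; apply: posM; [exact: (pp [::]) | exact: (pq [::])].
rewrite evw_cons /= ddM evwD; apply: posD; apply: IH => // u.
- exact: (pp ((OpE, i) :: u)).
- exact: (pq ((OpP, i) :: u)).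
- exact: (pp ((OpM, i) :: u)).
- exact: (pq ((OpE, i) :: u)).
Qed.

Lemma expansion_pos F G S (c : forest -> R) : uniq S ->
  (forall H, H \notin S -> c H = 0) -> (forall H, tconst (c H)) ->
  P F * P G = \sum_(H <- S) c H * P H -> forall H, pos (c H).
Proof.
move=> uS c0 cc e H; have [HS|/c0 ->] := boolP (H \in S); last exact: pos0.
have [w [wE wP]] := dual_word H.
have PtE K : Pt id K = P K by apply: relabel_id.
(* Evaluation along a word is linear over Z[t], and the dual word of [H] sends every other [P K] to
   0. *)
have cE : evw id w (P F * P G) = c H.
  rewrite e evw_sum (bigD1_seq H) //= evwZ // -[P H]PtE wP eqxx mulr1.
  rewrite big1 ?addr0 // => K KH.
  by rewrite evwZ // -PtE wP eq_sym (negbTE KH) mulr0.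
have inc : increasing id by [].
rewrite -cE; apply: evw_mul_pos => // u; rewrite -PtE; exact: evw_P_pos.
Qed.

End Family.
End FreeRing.

(** * Polynomials and substitution *)

(** The monomial part of [msubst], named so that its multiplicativity can be declared and [msubst s]
    becomes a ring morphism. *)
Definition monom_eval (s : var -> xtpoly) (m : {cmonom var}) : xtpoly :=
  \prod_(v <- finsupp m) s v ^+ (m v).

Lemma monom_evalEw s (m : {cmonom var}) (d : {fset var}) : (finsupp m `<=` d)%fset ->
  monom_eval s m = \prod_(v <- d) s v ^+ (m v).
Proof.
move=> le; rewrite /monom_eval (big_fset_incl _ le) //= => v _.
by rewrite -cmE_eq0 => /eqP ->; rewrite expr0.
Qed.

Lemma monom_eval_morph s : mmorphism (monom_eval s).
Proof.
split=> [m1 m2|]; last by rewrite /monom_eval mdom1 big_seq_fset0.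
rewrite (monom_evalEw s (d := finsupp (mmul m1 m2))) //.
rewrite (@monom_evalEw s m1 (finsupp (mmul m1 m2))) ?mdomD ?fsubsetUl //.
rewrite (@monom_evalEw s m2 (finsupp m1 `|` finsupp m2)%fset) ?fsubsetUr //.
by rewrite -big_split /=; apply: eq_bigr => v _; rewrite cmM exprD.
Qed.

HB.instance Definition _ s :=
  isMultiplicative.Build _ xtpoly (monom_eval s) (monom_eval_morph s).

Lemma msubst_is_additive s : additive (msubst s).
Proof.
exact: (@mmap_is_additive _ _ _ (@mkmalgU {cmonom var} int mone) (monom_eval s)).
Qed.

Lemma msubst_is_multiplicative s : multiplicative (msubst s).
Proof.
exact: (@mmap_is_multiplicative _ _ _ (@mkmalgU {cmonom var} int mone)
          (monom_eval s)).
Qed.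

HB.instance Definition _ s :=
  GRing.isAdditive.Build xtpoly xtpoly (msubst s) (msubst_is_additive s).
HB.instance Definition _ s :=
  GRing.isMultiplicative.Build xtpoly xtpoly (msubst s)
    (msubst_is_multiplicative s).

Definition V (v : var) : xtpoly := << ucm v >>.

Lemma msubstU s (c : int) m : msubst s << c *g m >> = c%:MP * monom_eval s m.
Proof.
exact: (@mmapU _ _ _ (@mkmalgU {cmonom var} int mone) (monom_eval s)).
Qed.

Lemma msubstV s v : msubst s (V v) = s v.
Proof.
by rewrite msubstU mul1r /monom_eval mdomU big_seq_fset1 cmUU expr1.
Qed.

Lemma msubstX s i : msubst s (X i) = s (false, i).
Proof. exact: msubstV. Qed.

Lemma msubstT s i : msubst s (T i) = s (true, i).
Proof. exact: msubstV. Qed.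

Lemma msubstC s (c : int) : msubst s c%:MP = c%:MP.
Proof. by rewrite msubstU mmorph1 mulr1. Qed.

Definition monomial (m : {cmonom var}) : xtpoly := << m >>.

Lemma monomialM a b : monomial (mmul a b) = monomial a * monomial b.
Proof. by rewrite malgM_def fgmulUU mulr1. Qed.

Lemma monomial1 : monomial mone = 1.
Proof. by []. Qed.

Lemma monomialE m : monomial m = monom_eval V m.
Proof.
have iterE v n : V v ^+ n = monomial (iter n (mmul (ucm v)) mone).
  elim: n => [|n IH]; first by rewrite expr0 -monomial1.
  by rewrite iterS exprS monomialM IH.
rewrite /monom_eval; under eq_bigr => v _ do rewrite iterE.
rewrite -(big_morph _ monomialM monomial1); congr monomial; apply/eqP/cmP => w.
have coefE v n : iter n (mmul (ucm v)) mone w = ((v == w) * n)%N.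
  elim: n => [|n IH]; first by rewrite cm1 muln0.
  by rewrite iterS cmM cmU IH mulnS.
rewrite (big_morph (fun m' : {cmonom var} => m' w) (fun a b => cmM w a b) (cm1 w)).
under eq_bigr => v _ do rewrite coefE.
have [wm|wm] := boolP (w \in finsupp m).
  rewrite (big_fsetD1 w) //= eqxx mul1n big_seq big1 ?addn0 // => v.
  by rewrite !inE => /andP[/negbTE ->].
rewrite big_seq big1 => [|v vm]; first by apply/eqP; rewrite cmE_eq0.
by case: eqP => // e; rewrite e (negPf wm) in vm.
Qed.

Lemma malgUE (c : int) m : << c *g m >> = c%:MP * monom_eval V m :> xtpoly.
Proof. by rewrite -monomialE malgM_def fgmulUU mulr1 mul1m. Qed.

Lemma xtpoly_ind (Q : xtpoly -> Prop) :
  (forall c : int, Q c%:MP) -> (forall v, Q (V v)) ->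
  (forall p q, Q p -> Q q -> Q (p + q)) ->
  (forall p q, Q p -> Q q -> Q (p * q)) -> forall p, Q p.
Proof.
move=> QC QV QD QM p; rewrite (monalgE p).
have Q0 : Q 0 by rewrite -malgC0E; exact: QC.
have Q1 : Q 1 by rewrite -mpolyC1E; exact: QC.
apply: (big_ind Q Q0 QD) => m _; rewrite malgUE; apply: (QM _ _ (QC _)).
apply: (big_ind Q Q1 QM) => v _.
elim: (m v) => [|n IH]; first by rewrite expr0.
rewrite exprS; exact: (QM _ _ (QV v) IH).
Qed.

Lemma rmorph_xtpoly_eq (f g : {rmorphism xtpoly -> xtpoly}) :
  (forall c : int, f c%:MP = g c%:MP) -> (forall v, f (V v) = g (V v)) -> f =1 g.
Proof.
move=> fC fV; apply: xtpoly_ind => [||p q fp fq|p q fp fq]; [exact: fC|exact: fV| |].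
  by rewrite !rmorphD fp fq.
by rewrite !rmorphM fp fq.
Qed.

Lemma eq_msubst s1 s2 : s1 =1 s2 -> msubst s1 =1 msubst s2.
Proof.
move=> e; apply: (@rmorph_xtpoly_eq (msubst s1) (msubst s2)) => [c|v] /=.
  by rewrite !msubstC.
rewrite !msubstV; exact: e.
Qed.

Lemma msubst_comp s1 s2 p : msubst s1 (msubst s2 p) = msubst (msubst s1 \o s2) p.
Proof.
apply: (@rmorph_xtpoly_eq (msubst s1 \o msubst s2)) => [c|v] /=.
  by rewrite !msubstC.
by rewrite !msubstV.
Qed.

Lemma msubst_id s p : s =1 V -> msubst s p = p.
Proof.
move=> sV; apply: (@rmorph_xtpoly_eq (msubst s) idfun) => [c|v] /=.
  by rewrite msubstC.
by rewrite msubstV sV.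
Qed.

(** Multiplication by a variable is injective on monomials, so only one term of [p] contributes. *)
Lemma mcoeffVM v (m : {cmonom var}) (p : xtpoly) :
  (V v * p)@_(mmul (ucm v) m) = p@_m.
Proof.
rewrite (mcoeffMlw _ msuppU_le (fsubset_refl _)) big_seq_fset1 [in RHS](monalgE p).
rewrite [RHS]raddf_sum; apply: eq_bigr => k _ /=.
rewrite mcoeffUU mul1r mcoeffU; congr (_ *+ nat_of_bool _).
apply/eqP/eqP => [e|-> //]; apply/eqP/cmP => w.
by have := congr1 (fun m' : {cmonom var} => m' w) e; rewrite !cmM => /addnI.
Qed.

(* The automorphism x_i -> x_i + t_k reduces the claim to cancelling the
   monomial x_i. *)
Lemma mulXT_inj i k (p q : xtpoly) :
  (X i - T k) * p = (X i - T k) * q -> p = q.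
Proof.
pose s (e : xtpoly) (v : var) : xtpoly := if v == (false, i) then V v + e else V v.
have s_xi e : s e (false, i) = X i + e by rewrite /s eqxx.
have s_t e l : s e (true, l) = T l by rewrite /s; case: eqP => // -[].
have sK : cancel (msubst (s (T k))) (msubst (s (- T k))).
  move=> r; rewrite msubst_comp; apply: msubst_id => v; rewrite [LHS]/=.
  have [->|ne] := eqVneq v (false, i); last first.
    by rewrite /s (negbTE ne) msubstV (negbTE ne).
  by rewrite s_xi rmorphD [X in X + _]msubstX [X in _ + X]msubstT s_xi s_t subrK.
have sM r : msubst (s (T k)) ((X i - T k) * r) = V (false, i) * msubst (s (T k)) r.
  rewrite [LHS]rmorphM; congr (_ * _).
  by rewrite [LHS]rmorphB [X in X - _]msubstX [X in _ - X]msubstT s_xi s_t addrK.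
move=> /(congr1 (msubst (s (T k)))) epq.
have e := etrans (esym (sM p)) (etrans epq (sM q)).
apply: (can_inj sK); apply/malgP => m.
have em := congr1 (mcoeff (mmul (ucm (false, i)) m)) e.
exact: etrans (esym (mcoeffVM _ _ _)) (etrans em (mcoeffVM _ _ _)).
Qed.

Lemma xtpoly_gen_ind (Q : xtpoly -> Prop) :
  Q 1 -> (forall i, Q (X i)) -> (forall i, Q (T i)) -> (forall p, Q p -> Q (- p)) ->
  (forall p q, Q p -> Q q -> Q (p + q)) ->
  (forall p q, Q p -> Q q -> Q (p * q)) -> forall p, Q p.
Proof.
move=> Q1 QX QT QN QD QM; apply: xtpoly_ind => [c|[[] i]||].
- have Qn n : Q n%:R.
    elim: n => [|n IH]; first by rewrite mulr0n -(subrr 1); exact: (QD _ _ Q1 (QN _ Q1)).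
    rewrite mulrS; exact: (QD _ _ Q1 IH).
  have Qz (n : nat) : Q (n%:R : int)%:MP by rewrite mpolyC_nat; exact: Qn.
  case: (intP c) => [|n|n]; first exact: (Qz 0%N).
    by rewrite -[n.+1%:Z]natz; exact: Qz.
  by rewrite -[n.+1%:Z]natz monalgUN; exact: (QN _ (Qz _)).
- exact: QT.
- exact: QX.
- exact: QD.
- exact: QM.
Qed.

Lemma in_Zt_msubst s p : (forall v, in_Zt (s v)) -> in_Zt (msubst s p).
Proof.
move=> sZ; elim/xtpoly_ind: p => [c|v|p q Zp Zq|p q Zp Zq].
- rewrite msubstC => m /(fsubsetP (msuppC_le _)); rewrite inE => /eqP -> j.
  exact: cm1.
- rewrite msubstV; exact: sZ.
- rewrite rmorphD => m /(fsubsetP (msuppD_le _ _)); rewrite inE => /orP[/Zp|/Zq]; exact.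
- rewrite rmorphM => m /msuppM_le[m1 [m2 [m1p m2q ->]]] j.
  by rewrite cmM (Zp _ m1p) (Zq _ m2q).
Qed.

Lemma msubst_in_Zt s p : (forall i, s (true, i) = T i) -> in_Zt p -> msubst s p = p.
Proof.
move=> sT Zp; transitivity (msubst V p); last exact: msubst_id.
have em m : m \in msupp p -> monom_eval s m = monom_eval V m.
  move=> mp; apply: eq_big_seq => -[[] j] jm; first by rewrite sT.
  by move: jm; rewrite -cmE_neq0 (Zp _ mp).
rewrite /msubst /mmap.
apply: eq_big_seq => m mp.
exact: (congr1 (GRing.mul _) (em m mp)).
Qed.

(** * The concrete polynomial ring as an instance of the abstract one *)

Definition xtsub (a b : nat -> xtpoly) : {rmorphism xtpoly -> xtpoly} :=
  msubst (fun v => if v.1 then b v.2 else a v.2).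

Lemma xtsubX a b i : xtsub a b (X i) = a i.
Proof. exact: msubstX. Qed.

Lemma xtsubT a b i : xtsub a b (T i) = b i.
Proof. exact: msubstT. Qed.

Lemma tconst_in_Zt c : in_Zt c -> tconst T xtsub c.
Proof. by move=> Zc a; apply: msubst_in_Zt. Qed.

Lemma in_Zt_T k : in_Zt (T k).
Proof. by move=> m /(fsubsetP msuppU_le); rewrite inE => /eqP -> j; rewrite cmU. Qed.

(** Invariance under x := t presents [c] as a substitution all of whose values lie in Z[t]. *)
Lemma in_Zt_tconst c : tconst T xtsub c -> in_Zt c.
Proof.
move=> /(_ T) <-; apply: in_Zt_msubst => -[[] k]; exact: in_Zt_T.
Qed.

Theorem theorem11p6 (P : forest -> xtpoly) :
  double_forest_family P ->
  forall F G : forest,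
    (exists (S : seq forest) (c : forest -> xtpoly),
        expansion P (P F * P G)%R S c)
    /\ (forall (S : seq forest) (c : forest -> xtpoly),
          expansion P (P F * P G)%R S c -> forall H : forest, graham_pos (c H)).
Proof.
move=> [_ P_xtot P_diff] F G.
have P_ev H : ev T xtsub id (P H) = (H == forest_empty)%:R.
  by rewrite -P_xtot; apply: eq_msubst => -[[] k].
have P_dd H i : dd xtsubX xtsubT xtpoly_gen_ind i i (P H) =
    if i \in Qdes H then xtsub X (T \o skip i id) (P (fcontract H i)) else 0.
  have plusE p : ins X T xtsub i.+1 i p = Rplus i p.
    by apply: eq_msubst => -[[] j].
  have minusE p : ins X T xtsub i i p = Rminus i p.
    by apply: eq_msubst => -[[] j].
  have thatE p : xtsub X (T \o skip i id) p = that i p.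
    by apply: eq_msubst => -[[] j] //=; rewrite /skip; case: ifP.
  (* [P_diff] is the recursion with denominators cleared, and this form determines [dd] because x_i
     - t_i is regular. *)
  apply: (dd_uniq _ _ _ mulXT_inj).
  apply: etrans _ (esym (congr2 (fun p q : xtpoly => p - q) (plusE _) (minusE _))).
  apply: etrans _ (esym (P_diff H i)); case: ifP => _; last exact: mulr0.
  exact: (congr1 (GRing.mul (X i - T i)) (thatE _)).
split.
  have [S [c [uS c0 cc e]]] := expansion_exists mulXT_inj P_ev P_dd (P F * P G).
  by exists S, c; split=> // H; apply: in_Zt_tconst.
move=> S c [uS c0 cZ e].
apply: (expansion_pos mulXT_inj P_ev P_dd (pos := graham_pos) _ _ _ _ uS c0 _ e).
- exact: gp_nat.
- exact: gp_gen.
- exact: gp_add.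
- exact: gp_mul.
- by move=> H; apply: tconst_in_Zt.
Qed.
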